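(* Let $n\ge 1$ and let $\eta,\eta'$ be partitions of $n$ with $\eta\succ\eta'$ in the dominance order, i.e. $\sum_{i=1}^{j}\eta_i\ge\sum_{i=1}^{j}\eta'_i$ for every $j$. Then for every Hermitian non-negative definite (positive semidefinite) $n\times n$ complex matrix $A$, $$\binom{n}{\eta}^{-1}\hat d_{[\eta]}(A)\;\ge\;\binom{n}{\eta'}^{-1}\hat d_{[\eta']}(A).$$
   Context: A partition of $n$ is a sequence of integers $\eta=(\eta_1\ge\eta_2\ge\cdots\ge\eta_n\ge 0)$ with $\sum_i\eta_i=n$; $\binom{n}{\eta}=\frac{n!}{\prod_i\eta_i!}$ is the multinomial coefficient. For a partition $\eta$ of $n$, $[\eta]$ denotes the character of the symmetric group $S_n$ induced from the trivial character of the Young subgroup $S_{\eta_1}\times S_{\eta_2}\times\cdots\times S_{\eta_n}$. Equivalently, $[\eta]$ is the character of $S_n$ acting by permuting tensor positions on the span of those basis tensors $v_{i_1}\otimes\cdots\otimes v_{i_n}$ of $(\mathbb{C}^n)^{\otimes n}$ in which the basis vector $v_j$ occurs exactly $\eta_j$ times for each $j$. For a function $f:S_n\to\mathbb{C}$ and an $n\times n$ complex matrix $A$, put $d_f(A)=\sum_{\sigma\in S_n}f(\sigma)\prod_{i=1}^n A_{i\,\sigma(i)}$ and $$\hat d_f(A)=\int_{U_n}d_f(uAu^{*})\,du,$$ where $du$ is the normalized Haar measure (total mass $1$) on the unitary group $U_n$. *)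

(* Defs.v *)
From HB Require Import structures.
From mathcomp Require Import all_boot all_order all_algebra all_fingroup.
From mathcomp Require Import all_field all_character complex.
From mathcomp Require Import all_classical all_reals all_analysis.

Set Implicit Arguments.
Unset Strict Implicit.
Unset Printing Implicit Defensive.

Import Order.TTheory GRing.Theory Num.Theory.
Import numFieldNormedType.Exports.

Local Open Scope classical_set_scope.
Local Open Scope ring_scope.
Local Open Scope sesquilinear_scope.

(* Partitions of n, padded with zeros to exactly n parts.                     *)

Definition is_partition (n : nat) (eta : n.-tuple nat) : bool :=
  sorted geq eta && (sumn eta == n).

Definition dominates (n : nat) (eta eta' : n.-tuple nat) : Prop :=
  forall j : nat, (j <= n)%N ->
    (\sum_(i < n | (i < j)%N) tnth eta' i
       <= \sum_(i < n | (i < j)%N) tnth eta i)%N.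

Definition multinomial (F : fieldType) (n : nat) (eta : n.-tuple nat) : F :=
  n`!%:R / \prod_(i < n) (tnth eta i)`!%:R.

(* For a partition eta of n, [reshape_index eta] sends the first eta_1        *)
(* indices to 0, the next eta_2 indices to 1, etc.                            *)
Definition young_subgroup (n : nat) (eta : n.-tuple nat) : {set 'S_n} :=
  [set s : 'S_n |
    [forall i : 'I_n, reshape_index eta (s i) == reshape_index eta i]]%SET.

Lemma young_subgroup_group_set (n : nat) (eta : n.-tuple nat) :
  group_set (young_subgroup eta).
Proof.
apply/group_setP; split=> [|s t].
  by rewrite inE; apply/forallP => i; rewrite perm1.
rewrite !inE => /forallP sP /forallP tP; apply/forallP => i.
by rewrite permM (eqP (tP _)) (eqP (sP _)).
Qed.

Canonical young_subgroup_group (n : nat) (eta : n.-tuple nat) :=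
  Group (young_subgroup_group_set eta).

(* The induced-character formula for the trivial character of the Young       *)
(* subgroup. Class functions in MathComp take their values in [algC]; here    *)
(* the values are needed in R[i], hence the generic field F. See              *)
(* [young_charE] for the agreement with the induction of class functions.     *)
Definition young_char (F : fieldType) (n : nat) (eta : n.-tuple nat)
    (s : 'S_n) : F :=
  #|young_subgroup eta|%:R^-1 *
    \sum_(t : 'S_n) ((s ^ t)%g \in young_subgroup eta)%:R.

Lemma young_charE (n : nat) (eta : n.-tuple nat) (s : 'S_n) :
  young_char algC eta s =
  ('Ind[[set: 'S_n]%G, young_subgroup eta] 1)%CF s.
Proof.
rewrite cfIndE ?finset.subsetT// /young_char; congr (_ * _).
by apply: eq_big => [t|t _]; [rewrite finset.in_setT|rewrite cfun1E].
Qed.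

Definition dfun (F : fieldType) (n : nat) (f : 'S_n -> F) (A : 'M[F]_n) : F :=
  \sum_(s : 'S_n) f s * \prod_(i < n) A i (s i).

Definition psdmx (F : numClosedFieldType) (n : nat) (A : 'M[F]_n) : Prop :=
  A \is hermsymmx /\ forall v : 'cV[F]_n, 0 <= (v^t* *m A *m v) 0 0.

Definition unitary (R : realType) (n : nat) : Type :=
  {u : 'M[R[i]]_n | u \is unitarymx}.

Section UnitaryGroup.
Variables (R : realType) (n : nat).

Lemma unitary1_subproof : (1%:M : 'M[R[i]]_n) \is unitarymx.
Proof. by apply/unitarymxP; rewrite trmx1 map_mx1 mulmx1. Qed.

HB.instance Definition _ := SubChoice.on (unitary R n).

Definition unitary1 : unitary R n := Sub 1%:M unitary1_subproof.

Lemma unitary_mul_subproof (u v : unitary R n) :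
  val u *m val v \is unitarymx.
Proof. by apply: mul_unitarymx; exact: valP. Qed.

Definition unitary_mul (u v : unitary R n) : unitary R n :=
  Sub (val u *m val v) (unitary_mul_subproof u v).

HB.instance Definition _ := isPointed.Build (unitary R n) unitary1.

(* The subspace topology inherited from 'M[R[i]]_n; the topology of R[i]      *)
(* induced by its norm is attached to the regular module R[i]^o.              *)
HB.instance Definition _ := Topological.copy (unitary R n)
  (initial_topology (fun u : unitary R n => val u : 'M[R[i]^o]_n)).

End UnitaryGroup.

Notation unitary_borel R n := (g_sigma_algebraType (@open (unitary R n))).

(* Left invariance and total mass 1 characterize normalized Haar measure.     *)
Definition is_haar (R : realType) (n : nat)
    (mu : probability (unitary_borel R n) R) : Prop :=
  forall (v : unitary R n) (B : set (unitary_borel R n)),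
    measurable B -> mu (unitary_mul v @^-1` B) = mu B.

Definition Cintegral d (T : measurableType d) (R : realType)
    (mu : {measure set T -> \bar R}) (f : T -> R[i]) : R[i] :=
  Complex (Rintegral mu setT (fun x => complex.Re (f x)))
          (Rintegral mu setT (fun x => complex.Im (f x))).

Definition dhat (R : realType) (n : nat)
    (mu : probability (unitary_borel R n) R)
    (f : 'S_n -> R[i]) (A : 'M[R[i]]_n) : R[i] :=
  Cintegral mu
    (fun u : unitary R n => dfun f (val u *m A *m (val u)^t*)).

(* Main.v *)
(* Write X = u A u^* for a Haar unitary u. The heart of the proof is the
   identity
   binom(n, eta)^-1 * dhat_[eta](A) = E [prod_j X_jj ^ eta_j],
   after which the inequality is Muirhead's: the diagonal entries X_jj are
   nonnegative and exchangeable, and x^a y^b + x^b y^a decreases when the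
   exponents a > b are brought closer together by one unit.
   For the identity, the mean of the n-th tensor power of X commutes with the
   unitary group, hence with its complexified Lie algebra gl_n. Commutation
   with the elementary matrices gives a recursion which expresses
   E [prod_i X_(c i)(d i)], for maps c, d with the same fibre sizes, through
   the moments E [prod_i X_i(p i)], p a permutation; this replaces Schur-Weyl
   duality.
   For c = d the block map of eta, the permutations that occur are those of
   the Young subgroup, which is what the induced character sums over. *)

Require Import Defs.
From mathcomp Require Import all_boot all_order all_algebra all_fingroup.
From mathcomp Require Import complex ring zify.
From mathcomp Require Import all_classical all_reals all_analysis.
From mathcomp Require Import measurable_realfun.

Import Order.TTheory GRing.Theory Num.Theory.
Import numFieldNormedType.Exports.
Local Open Scope ring_scope.
Local Open Scope sesquilinear_scope.
Set Implicit Arguments.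
Unset Strict Implicit.
Unset Printing Implicit Defensive.

(** * Integrals of bounded measurable complex functions *)

(** Unlike integrability, this class is stable under products, and over a probability measure it
    lies in L1. The moments below have integrands polynomial in the entries of u and their
    conjugates, so only single entries need checking. *)
Definition bounded_measurable d (T : measurableType d) (R : realType)
    (f : T -> R) : Prop :=
  measurable_fun setT f /\ exists M, forall x, `|f x| <= M.

Definition bounded_measurableC d (T : measurableType d) (R : realType)
    (f : T -> R[i]) : Prop :=
  bounded_measurable (fun x => complex.Re (f x)) /\
  bounded_measurable (fun x => complex.Im (f x)).

Section BoundedMeasurable.
Context d (T : measurableType d) (R : realType).
Implicit Types (f g : T -> R).

Lemma bounded_measurable_cst (c : R) :
  bounded_measurable (fun _ : T => c).
Proof. by split; [exact: measurable_cst | exists `|c|]. Qed.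

Lemma bounded_measurableD f g : bounded_measurable f ->
  bounded_measurable g -> bounded_measurable (fun x => f x + g x).
Proof.
move=> [mf [M fM]] [mg [N gN]]; split; first exact: measurable_funD.
by exists (M + N) => x; rewrite (le_trans (ler_normD _ _))// lerD.
Qed.

Lemma bounded_measurableM f g : bounded_measurable f ->
  bounded_measurable g -> bounded_measurable (fun x => f x * g x).
Proof.
move=> [mf [M fM]] [mg [N gN]]; split; first exact: measurable_funM.
by exists (M * N) => x; rewrite normrM ler_pM.
Qed.

Lemma bounded_measurableN f : bounded_measurable f ->
  bounded_measurable (fun x => - f x).
Proof.
move=> bf; under [X in bounded_measurable X]funext do rewrite -mulN1r.
exact: bounded_measurableM (bounded_measurable_cst _) bf.
Qed.

Lemma eq_bounded_measurable f g : f =1 g ->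
  bounded_measurable f -> bounded_measurable g.
Proof. by move=> /funext ->. Qed.

Lemma bounded_measurable_integrable (mu : probability T R) f :
  bounded_measurable f -> mu.-integrable setT (EFin \o f).
Proof.
move=> [mf [M fM]]; apply: measurable_bounded_integrable => //.
  by rewrite [X in (X < _)%E](@probability_setT _ _ _ mu) ltry.
exists M; split=> [|N MN x _ /=]; first exact: num_real.
exact: le_trans (fM x) (ltW MN).
Qed.

End BoundedMeasurable.

Section BoundedMeasurableC.
Context d (T : measurableType d) (R : realType).
Implicit Types (f g : T -> R[i]).

Lemma eq_bounded_measurableC f g : f =1 g ->
  bounded_measurableC f -> bounded_measurableC g.
Proof. by move=> /funext ->. Qed.

Lemma bounded_measurableC_cst (c : R[i]) :
  bounded_measurableC (fun _ : T => c).
Proof. by split; exact: bounded_measurable_cst. Qed.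

Lemma bounded_measurableCD f g : bounded_measurableC f ->
  bounded_measurableC g -> bounded_measurableC (fun x => f x + g x).
Proof.
move=> [fr fi] [gr gi]; split.
  under [X in bounded_measurable X]funext do rewrite raddfD.
  exact: bounded_measurableD.
under [X in bounded_measurable X]funext do rewrite raddfD.
exact: bounded_measurableD.
Qed.

Lemma ReM (x y : R[i]) : complex.Re (x * y) =
  complex.Re x * complex.Re y - complex.Im x * complex.Im y.
Proof. by case: x y => [a b] [c e]. Qed.

Lemma ImM (x y : R[i]) : complex.Im (x * y) =
  complex.Re x * complex.Im y + complex.Im x * complex.Re y.
Proof. by case: x y => [a b] [c e]. Qed.

Lemma bounded_measurableCM f g : bounded_measurableC f ->
  bounded_measurableC g -> bounded_measurableC (fun x => f x * g x).
Proof.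
move=> [fr fi] [gr gi]; split.
  under [X in bounded_measurable X]funext do rewrite ReM.
  apply: bounded_measurableD; first exact: bounded_measurableM.
  exact/bounded_measurableN/bounded_measurableM.
under [X in bounded_measurable X]funext do rewrite ImM.
by apply: bounded_measurableD; apply: bounded_measurableM.
Qed.

Lemma bounded_measurableC_conj f : bounded_measurableC f ->
  bounded_measurableC (fun x => (f x)^*).
Proof.
move=> [fr fi]; split.
  by apply: eq_bounded_measurable fr => x; case: (f x).
by apply: eq_bounded_measurable (bounded_measurableN fi) => x; case: (f x).
Qed.

Lemma bounded_measurableC_sum (I : Type) (r : seq I) (P : pred I)
    (F : I -> T -> R[i]) : (forall i, bounded_measurableC (F i)) ->
  bounded_measurableC (fun x => \sum_(i <- r | P i) F i x).
Proof.
move=> bF; elim: r => [|i r IHr].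
  apply: eq_bounded_measurableC (bounded_measurableC_cst 0) => x.
  by rewrite big_nil.
have [Pi|nPi] := boolP (P i).
  apply: eq_bounded_measurableC (bounded_measurableCD (bF i) IHr) => x.
  by rewrite big_cons Pi.
by apply: eq_bounded_measurableC IHr => x; rewrite big_cons (negbTE nPi).
Qed.

Lemma bounded_measurableC_prod (I : Type) (r : seq I) (P : pred I)
    (F : I -> T -> R[i]) : (forall i, bounded_measurableC (F i)) ->
  bounded_measurableC (fun x => \prod_(i <- r | P i) F i x).
Proof.
move=> bF; elim: r => [|i r IHr].
  apply: eq_bounded_measurableC (bounded_measurableC_cst 1) => x.
  by rewrite big_nil.
have [Pi|nPi] := boolP (P i).
  apply: eq_bounded_measurableC (bounded_measurableCM (bF i) IHr) => x.
  by rewrite big_cons Pi.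
by apply: eq_bounded_measurableC IHr => x; rewrite big_cons (negbTE nPi).
Qed.

End BoundedMeasurableC.

Section ComplexIntegral.
Context d (T : measurableType d) (R : realType) (mu : probability T R).
Implicit Types (f g : T -> R[i]).

Lemma eq_Cintegral f g : f =1 g -> Cintegral mu f = Cintegral mu g.
Proof. by move=> /funext ->. Qed.

Lemma Cintegral_cst (c : R[i]) : Cintegral mu (fun=> c) = c.
Proof.
have mu1 : mu setT = 1%E := probability_setT mu.
rewrite /Cintegral !Rintegral_cst//= mu1 /= !mulr1.
by case: c.
Qed.

Lemma CintegralD f g : bounded_measurableC f -> bounded_measurableC g ->
  Cintegral mu (fun x => f x + g x) = Cintegral mu f + Cintegral mu g.
Proof.
move=> [fr fi] [gr gi]; rewrite /Cintegral.
under eq_Rintegral do rewrite raddfD.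
under [X in Complex _ X]eq_Rintegral do rewrite raddfD.
by rewrite !RintegralD//; exact: bounded_measurable_integrable.
Qed.

Lemma CintegralZ (c : R[i]) f : bounded_measurableC f ->
  Cintegral mu (fun x => c * f x) = c * Cintegral mu f.
Proof.
move=> [fr fi]; rewrite /Cintegral.
under eq_Rintegral do rewrite ReM.
under [X in Complex _ X]eq_Rintegral do rewrite ImM.
have Zi (a : R) (h : T -> R) : bounded_measurable h ->
    bounded_measurable (fun x => a * h x).
  by move=> bh; apply: bounded_measurableM bh; exact: bounded_measurable_cst.
rewrite RintegralB// ?RintegralD// ?RintegralZl//;
  try exact/bounded_measurable_integrable/Zi.
all: try exact: bounded_measurable_integrable.
by case: c.
Qed.

Lemma Cintegral_sum (I : Type) (r : seq I) (P : pred I)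
    (F : I -> T -> R[i]) : (forall i, bounded_measurableC (F i)) ->
  Cintegral mu (fun x => \sum_(i <- r | P i) F i x) =
  \sum_(i <- r | P i) Cintegral mu (F i).
Proof.
move=> bF; elim: r => [|i r IHr].
  rewrite big_nil; under eq_Cintegral do rewrite big_nil.
  exact: Cintegral_cst.
rewrite big_cons; under eq_Cintegral do rewrite big_cons.
case: ifP => // _; rewrite CintegralD ?IHr//.
exact: bounded_measurableC_sum.
Qed.

Lemma CintegralB f g : bounded_measurableC f -> bounded_measurableC g ->
  Cintegral mu (fun x => f x - g x) = Cintegral mu f - Cintegral mu g.
Proof.
move=> bf bg; under eq_Cintegral do rewrite -mulN1r.
rewrite CintegralD ?CintegralZ ?mulN1r//.
by apply: bounded_measurableCM bg; exact: bounded_measurableC_cst.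
Qed.

Lemma Cintegral_ge0 f : (forall x, 0 <= f x) -> 0 <= Cintegral mu f.
Proof.
(* In [R[i]], 0 <= z means Im z = 0 and 0 <= Re z, so the imaginary part integrates the zero
   function. *)
move=> f0; rewrite /Cintegral lecE /=; apply/andP; split.
  rewrite -[X in _ == X](_ : Rintegral mu setT (fun=> 0) = 0).
    apply/eqP/eq_Rintegral => x _.
    by have := f0 x; rewrite lecE => /andP[/eqP].
  by rewrite Rintegral_cst ?mul0r.
by apply: Rintegral_ge0 => x _; have := f0 x; rewrite lecE => /andP[].
Qed.

End ComplexIntegral.

(** * The Haar measure on the unitary group *)

Lemma normc_ge_Im (R : rcfType) (x : R[i]) :
  (`|complex.Im x|%:C)%C <= `|x|.
Proof.
by case: x => a b; simpc; rewrite -sqrtr_sqr ler_wsqrtr // lerDr sqr_ge0.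
Qed.

Section MatrixContinuity.
Context (X : topologicalType) (K : numFieldType).
Local Open Scope classical_set_scope.

Lemma mx_continuous (T : topologicalType) m n (f : X -> 'M[T]_(m, n)) :
  (forall i j, continuous (fun x => f x i j)) -> continuous f.
Proof.
move=> cf x A [P fP PA].
have h i : \forall w \near x, forall j, P i j (f w i j).
  by apply: filter_forall => j; apply: (cf i j x (P i j)); exact: fP.
by apply: filterS (filter_forall _ h) => w; exact: PA.
Qed.

Lemma mulmx_entry_continuous m n p (A : 'M[K^o]_(m, n))
    (f : X -> 'M[K^o]_(n, p)) (i : 'I_m) (j : 'I_p) :
  (forall k, continuous (fun x => f x k j)) ->
  continuous (fun x => (A *m f x) i j).
Proof.
move=> cf x; rewrite /continuous_at mxE; under eq_cvg do rewrite mxE.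
apply: (@cvg_big K^o _ +%R); first exact: add_continuous.
by move=> k _; apply: cvgM; [exact: cvg_cst | exact: cf].
Qed.

End MatrixContinuity.

Section UnitaryMeasurability.
Context (R : realType) (n : nat).
Local Open Scope classical_set_scope.

Lemma unitary_entry_continuous (i j : 'I_n) :
  continuous (fun u : unitary R n => (val u i j : R[i]^o)).
Proof.
move=> u; apply: (@continuous_comp _ _ _
  (fun u : unitary R n => (val u : 'M[R[i]^o]_n))
  (fun M : 'M[R[i]^o]_n => M i j)).
  exact: initial_continuous.
exact: coord_continuous.
Qed.

Lemma Re_continuous : continuous (fun z : R[i]^o => complex.Re z : R).
Proof.
move=> z A /nbhs_ballP[e /= e0 eA]; apply/nbhs_ballP.
exists (e%:C)%C => /=; first by rewrite ltcR.
move=> w /= zw; apply: eA; rewrite /ball/= -raddfB -ltcR.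
exact: le_lt_trans (normc_ge_Re _) zw.
Qed.

Lemma Im_continuous : continuous (fun z : R[i]^o => complex.Im z : R).
Proof.
move=> z A /nbhs_ballP[e /= e0 eA]; apply/nbhs_ballP.
exists (e%:C)%C => /=; first by rewrite ltcR.
move=> w /= zw; apply: eA; rewrite /ball/= -raddfB -ltcR.
exact: le_lt_trans (normc_ge_Im _) zw.
Qed.

Lemma continuous_unitary_measurable (f : unitary R n -> R) :
  continuous f -> measurable_fun setT (f : unitary_borel R n -> R).
Proof.
move=> /continuousP cf; apply: (measurability _ (RGenOpens.measurableE R)).
move=> _ [_ [a [b ->] <-]]; rewrite setTI; apply: sub_sigma_algebra.
exact/cf/interval_open.
Qed.

(** The squared moduli along row i sum to 1, being a diagonal entry of u u^* = 1. *)
Lemma unitary_entry_le1 (u : unitary R n) (i j : 'I_n) : `|val u i j| <= 1.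
Proof.
have /matrixP /(_ i i) := unitarymxP (valP u).
rewrite !mxE eqxx (bigD1 j)//= !mxE -normCK => e.
rewrite -(@expr_le1 _ 2)// -[leRHS]e lerDl sumr_ge0// => k _.
by rewrite !mxE -normCK exprn_ge0.
Qed.

Lemma bounded_measurable_entry (i j : 'I_n) :
  bounded_measurableC (fun u : unitary_borel R n => val (u : unitary R n) i j).
Proof.
split; split.
- apply: (@continuous_unitary_measurable (fun u => complex.Re (val u i j))).
  move=> u; exact: (@continuous_comp _ _ _
    (fun u : unitary R n => (val u i j : R[i]^o)) (fun z => complex.Re z)
    u (@unitary_entry_continuous i j u) (@Re_continuous _)).
- exists 1 => u; rewrite -lecR (le_trans (normc_ge_Re _))//.
  exact: unitary_entry_le1.
- apply: (@continuous_unitary_measurable (fun u => complex.Im (val u i j))).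
  move=> u; exact: (@continuous_comp _ _ _
    (fun u : unitary R n => (val u i j : R[i]^o)) (fun z => complex.Im z)
    u (@unitary_entry_continuous i j u) (@Im_continuous _)).
- exists 1 => u; rewrite -lecR (le_trans (normc_ge_Im _))//.
  exact: unitary_entry_le1.
Qed.

Lemma unitary_mul_continuous (v : unitary R n) : continuous (unitary_mul v).
Proof.
apply/continuousP => _ [B oB <-].
have /continuousP cf : continuous (fun u : unitary R n =>
    (val v *m val u : 'M[R[i]^o]_n)); last exact: cf.
apply: mx_continuous => i j u.
exact: (@mulmx_entry_continuous (unitary R n) R[i] n n n (val v)
  (fun u => val u) i j (fun k => @unitary_entry_continuous k j) u).
Qed.

Lemma unitary_mul_measurable (v : unitary R n) :
  measurable_fun setT (unitary_mul v : unitary_borel R n -> unitary_borel R n).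
Proof.
apply: (@measurability _ _ (unitary_borel R n) (unitary_borel R n) setT
  (unitary_mul v) (@open (unitary R n)) erefl).
move=> _ [B oB <-]; rewrite setTI; apply: sub_sigma_algebra.
by move/continuousP: (@unitary_mul_continuous v); apply.
Qed.

End UnitaryMeasurability.

Section HaarInvariance.
Context (R : realType) (n : nat) (mu : probability (unitary_borel R n) R).
Hypothesis hmu : is_haar mu.

(** Invariance on sets says that mu is its own pushforward under left translation; change of
    variables carries this over to integrals. *)
Lemma haar_Rintegral (v : unitary R n) (f : unitary_borel R n -> R) :
  bounded_measurable f ->
  Rintegral mu setT (fun u => f (unitary_mul v u)) = Rintegral mu setT f.
Proof.
move=> bf; rewrite /Rintegral; congr fine.
have mv := unitary_mul_measurable v.
have [mf [M fM]] := bf.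
have := @integral_pushforward _ _ _ _ R _ mv mu setT (EFin \o f).
rewrite preimage_setT => <-//.
- apply: eq_measure_integral => A mA _.
  exact: hmu.
- exact/measurable_EFinP.
- apply: (@bounded_measurable_integrable _ _ _ mu
    (fun u => f (unitary_mul v u))).
  split; last by exists M.
  exact: measurableT_comp mf mv.
Qed.

Lemma haar_Cintegral (v : unitary R n) (f : unitary_borel R n -> R[i]) :
  bounded_measurableC f ->
  Cintegral mu (fun u => f (unitary_mul v u)) = Cintegral mu f.
Proof.
move=> [fr fi]; rewrite /Cintegral.
by rewrite (haar_Rintegral v fr) (haar_Rintegral v fi).
Qed.

End HaarInvariance.

(** * Infinitesimal invariance of the mixed moments *)

(** In characteristic zero the naturals below the size of p are already too many distinct roots. *)
Lemma poly_nat_roots_eq0 (K : numDomainType) (p : {poly K}) :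
  (forall k : nat, p.[k%:R] = 0) -> p = 0.
Proof.
move=> p0; apply/eqP/contraT => /max_poly_roots h.
have := h [seq k%:R | k <- iota 0 (size p)].
rewrite size_map size_iota ltnn => -> //.
  by apply/allP => _ /mapP[k _ ->]; rewrite rootE p0.
by rewrite map_inj_uniq ?iota_uniq// => k l /eqP; rewrite eqr_nat => /eqP.
Qed.

(** The product rule at 0, the coefficient of degree 1 being the derivative there. *)
Lemma coef1_prod (K : comNzRingType) (I : eqType) (r : seq I)
    (p : I -> {poly K}) : uniq r ->
  (\prod_(i <- r) p i)`_1 =
  \sum_(i <- r) (p i)`_1 * \prod_(j <- r | j != i) (p j)`_0.
Proof.
elim: r => [|i r IHr] /=; first by rewrite !big_nil coef1.
case/andP=> ir ur; rewrite !big_cons eqxx /=.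
rewrite coefM big_ord_recl big_ord1 /= IHr// addrC; congr (_ * _ + _).
  rewrite coef0_prod big_seq [RHS]big_seq_cond; apply: eq_bigl => j.
  by case: eqVneq => [->|]; rewrite ?(negbTE ir)// andbT.
rewrite big_distrr /= big_seq [RHS]big_seq; apply: eq_bigr => j jr.
rewrite big_cons ifT; first by rewrite mulrCA.
by apply: contraNneq ir => ->.
Qed.

Lemma coef1_expr_1X2 (K : comNzRingType) m :
  ((1 + 'X^2 : {poly K}) ^+ m)`_1 = 0.
Proof.
have coef1_1X2 : (1 + 'X^2 : {poly K})`_1 = 0.
  by rewrite coefD coef1 coefXn addr0.
elim: m => [|m IHm]; first by rewrite expr0 coef1.
by rewrite exprS coefM big_ord_recl big_ord1 /= IHm coef1_1X2 mulr0 mul0r addr0.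
Qed.

(** * Conjugation by unitaries, and rotations built from reflections *)

Section Conjugation.
Context (R : realType) (n : nat).
Implicit Types (A B H : 'M[R[i]]_n) (v : unitary R n).

Definition unitary_conj A (u : unitary R n) : 'M[R[i]]_n :=
  val u *m A *m (val u)^t*.

Lemma unitary_conj_mul A v u : unitary_conj A (unitary_mul v u) =
  val v *m unitary_conj A u *m (val v)^t*.
Proof. by rewrite /unitary_conj /= trmx_mul map_mxM !mulmxA. Qed.

Lemma bounded_measurable_unitary_conj A i j : bounded_measurableC
  (fun u : unitary_borel R n => unitary_conj A u i j).
Proof.
apply: (@eq_bounded_measurableC _ _ _ (fun u : unitary_borel R n =>
    \sum_k (\sum_l val (u : unitary R n) i l * A l k) *
      (val (u : unitary R n) j k)^*)).
  by move=> u; rewrite !mxE; apply: eq_bigr => k _; rewrite !mxE.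
apply: bounded_measurableC_sum => k; apply: bounded_measurableCM.
  apply: bounded_measurableC_sum => l; apply: bounded_measurableCM.
    exact: bounded_measurable_entry.
  exact: bounded_measurableC_cst.
exact/bounded_measurableC_conj/bounded_measurable_entry.
Qed.

Lemma adjmx_mul m p q (X : 'M[R[i]]_(m, p)) (Y : 'M[R[i]]_(p, q)) :
  (X *m Y)^t* = Y^t* *m X^t*.
Proof. by rewrite trmx_mul map_mxM. Qed.

Lemma adjmx1 : (1%:M : 'M[R[i]]_n)^t* = 1%:M.
Proof. by rewrite trmx1 map_mx1. Qed.

Lemma adjmxK m p (X : 'M[R[i]]_(m, p)) : X^t*^t* = X.
Proof. by apply/matrixP => i j; rewrite !mxE conjCK. Qed.

Lemma adjmxD m p (X Y : 'M[R[i]]_(m, p)) : (X + Y)^t* = X^t* + Y^t*.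
Proof. by rewrite linearD map_mxD. Qed.

Lemma adjmxZ m p (a : R[i]) (X : 'M[R[i]]_(m, p)) :
  (a *: X)^t* = a^* *: X^t*.
Proof. by rewrite linearZ map_mxZ. Qed.

(** The factors are 1 + kiH and 1 - kiH: the cross terms cancel and H^2 = 1 leaves 1 + k^2. *)
Lemma reflection_rotation H (k : nat) (w := 1%:M + (k%:R * 'i) *: H) :
  H^t* = H -> H *m H = 1%:M -> w *m w^t* = (1 + k%:R ^+ 2)%:M.
Proof.
move=> Hh HH; rewrite /w adjmxD adjmx1 adjmxZ Hh.
rewrite rmorphM /= conjCi conjC_nat.
rewrite mulmxDl !mulmxDr !mul1mx !mulmx1 -!scalemxAl -!scalemxAr HH.
rewrite scalerA.
have -> : (k%:R * 'i) * (k%:R * - 'i) = k%:R ^+ 2 :> R[i].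
  by rewrite mulrACA mulrN -expr2 sqrCi opprK mulr1.
by rewrite mulrN scaleNr addrA subrK scalemx1 -raddfD.
Qed.

(* For a reflection H, i.e. H = H^* = H^-1, the matrix 1 + k i H is unitary up
   to the scalar sqrt (1 + k^2). *)
Definition rotation_mx H (k : nat) : 'M[R[i]]_n :=
  (sqrtC (1 + k%:R ^+ 2))^-1 *: (1%:M + (k%:R * 'i) *: H).

Lemma rotation_mx_unitary H k : H^t* = H -> H *m H = 1%:M ->
  rotation_mx H k \is unitarymx.
Proof.
move=> Hh HH; apply/unitarymxP.
have s0 : 0 < 1 + k%:R ^+ 2 :> R[i] by rewrite ltr_wpDr// exprn_ge0.
rewrite /rotation_mx adjmxZ -scalemxAl -scalemxAr reflection_rotation//.
rewrite scalerA geC0_conj ?invr_ge0 ?sqrtC_ge0 ?ltW// -invfM -expr2 sqrtCK.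
by rewrite scale_scalar_mx mulVf// gt_eqF.
Qed.

End Conjugation.

(** * Mixed moments of the entries of u A u^* under rotations *)

Section Moments.
Context (R : realType) (n : nat) (mu : probability (unitary_borel R n) R).
Hypothesis hmu : is_haar mu.
Context (A : 'M[R[i]]_n) (I : finType).
Implicit Types (c d : I -> 'I_n) (H M : 'M[R[i]]_n).

(** The entry at (c, d) of the mean of the tensor power of X = u A u^* indexed by [I]. *)
Definition haar_moment c d : R[i] :=
  Cintegral mu (fun u => \prod_i unitary_conj A u (c i) (d i)).

(** Conjugating u A u^* by V amounts to translating u by V on the left. *)
Lemma haar_conj_invariant (V : 'M[R[i]]_n) (F : 'M[R[i]]_n -> R[i]) :
  V \is unitarymx -> 
    bounded_measurableC (fun u : unitary_borel R n => F (unitary_conj A u)) ->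
  Cintegral mu (fun u => F (V *m unitary_conj A u *m V^t*)) =
  Cintegral mu (fun u => F (unitary_conj A u)).
Proof.
move=> uV bF; pose v : unitary R n := Sub V uV.
rewrite -(haar_Cintegral hmu v bF); apply: eq_Cintegral => u.
by rewrite unitary_conj_mul SubK.
Qed.

(** The entry (a, b) of (1 + tiH) B (1 - tiH) as a polynomial in t, for Hermitian H. Omitting the
    normalization by sqrt (1 + t^2) keeps it polynomial; its linear coefficient is i times the
    commutator of H and B. *)
Definition rotated_entry H (B : 'M[R[i]]_n) (a b : 'I_n) : {poly R[i]} :=
  (B a b)%:P + ('i * (H *m B - B *m H) a b) *: 'X
    + ((H *m B *m H) a b) *: 'X^2.

Lemma rotated_entryE H B a b k : H^t* = H ->
  (rotated_entry H B a b).[k%:R] =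
  ((1%:M + (k%:R * 'i) *: H) *m B *m (1%:M + (k%:R * 'i) *: H)^t*) a b.
Proof.
move=> Hh; rewrite /rotated_entry !hornerE adjmxD adjmx1 adjmxZ Hh.
rewrite rmorphM /= conjCi conjC_nat.
rewrite !(mulmxDl, mulmxDr) !mul1mx !mulmx1 -!scalemxAl -!scalemxAr.
move: (H *m B) (B *m H) => HB BH.
move: (HB *m H) => HBH.
rewrite !mxE.
have i2 := sqrCi R[i].
ring: i2.
Qed.


Definition rotated_monomial H c d (B : 'M[R[i]]_n) : {poly R[i]} :=
  \prod_i rotated_entry H B (c i) (d i).

Lemma bounded_measurable_monomial c d : bounded_measurableC
  (fun u : unitary_borel R n => \prod_i unitary_conj A u (c i) (d i)).
Proof.
by apply: bounded_measurableC_prod => i; exact: bounded_measurable_unitary_conj.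
Qed.

Lemma bounded_measurable_mulmx (f : unitary_borel R n -> 'M[R[i]]_n)
    (H K : 'M[R[i]]_n) :
  (forall i j, bounded_measurableC (fun u => f u i j)) ->
  forall i j, bounded_measurableC (fun u => (H *m f u *m K) i j).
Proof.
move=> bf i j.
apply: (@eq_bounded_measurableC _ _ _ (fun u =>
    \sum_k (\sum_l H i l * f u l k) * K k j)).
  by move=> u; rewrite !mxE; apply: eq_bigr => k _; rewrite !mxE.
apply: bounded_measurableC_sum => k; apply: bounded_measurableCM.
  apply: bounded_measurableC_sum => l; apply: bounded_measurableCM => //.
  exact: bounded_measurableC_cst.
exact: bounded_measurableC_cst.
Qed.

Lemma bounded_measurable_coef_prod disp (T : measurableType disp) (J : finType)
    (p : J -> T -> {poly R[i]}) :
  (forall j k, bounded_measurableC (fun x => (p j x)`_k)) ->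
  forall k, bounded_measurableC (fun x => (\prod_j p j x)`_k).
Proof.
move=> bp; elim: (index_enum J) => [|j r IHr] k.
  apply: (@eq_bounded_measurableC _ _ _ (fun=> (k == 0)%:R)).
    by move=> x; rewrite big_nil coef1.
  exact: bounded_measurableC_cst.
apply: (@eq_bounded_measurableC _ _ _ (fun x =>
   \sum_(l < k.+1) (p j x)`_l * (\prod_(j <- r) p j x)`_(k - l))).
  by move=> x; rewrite big_cons coefM.
by apply: bounded_measurableC_sum => l; apply: bounded_measurableCM.
Qed.

Lemma bounded_measurable_rotated_monomial H c d k : bounded_measurableC
  (fun u : unitary_borel R n => (rotated_monomial H c d (unitary_conj A u))`_k).
Proof.
apply: bounded_measurable_coef_prod => i {}k.
have bB := bounded_measurable_unitary_conj A.
have bl M := @bounded_measurable_mulmx _ M 1%:M bB.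
have br M := @bounded_measurable_mulmx _ 1%:M M bB.
have bm := @bounded_measurable_mulmx _ H H bB.
have bc := @bounded_measurableC_cst _ (unitary_borel R n) R.
pose B (u : unitary_borel R n) := unitary_conj A u.
(* Indicators of k select the coefficient, and one-sided products are padded with [1%:M] to fit
   [bounded_measurable_mulmx]. *)
apply: (@eq_bounded_measurableC _ _ _ (fun u : unitary_borel R n =>
   (B u) (c i) (d i) * (k == 0%N)%:R +
   'i * ((H *m B u *m 1%:M) (c i) (d i) + -1 * (1%:M *m B u *m H) (c i) (d i))
     * (k == 1%N)%:R + (H *m B u *m H) (c i) (d i) * (k == 2%N)%:R)).
  move=> u; rewrite /rotated_entry !coefD !coefZ coefC coefX coefXn.
  rewrite mulmx1 mul1mx -/(B u) mulN1r.
  congr (_ + _ + _); first by case: ifP; rewrite ?mulr1 ?mulr0.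
  by congr (_ * _ * _); rewrite !mxE.
apply: bounded_measurableCD; last by apply: bounded_measurableCM.
apply: bounded_measurableCD; first by apply: bounded_measurableCM.
apply: bounded_measurableCM => //; apply: bounded_measurableCM => //.
by apply: bounded_measurableCD => //; apply: bounded_measurableCM.
Qed.

End Moments.

(** * Invariance under the Lie algebra gl_n *)

Section LieInvariance.
Context (R : realType) (n : nat) (mu : probability (unitary_borel R n) R).
Hypothesis hmu : is_haar mu.
Context (A : 'M[R[i]]_n) (I : finType).
Implicit Types (c d : I -> 'I_n) (H M : 'M[R[i]]_n).

(** The bound does not depend on [B], so integrating coefficientwise yields a polynomial. It is
    generous enough to keep degree 1 in range even for empty [I]. *)
Lemma size_rotated_monomial H c d B :
  (size (rotated_monomial H c d B) <= (3 * #|I|).+2)%N.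
Proof.
apply: leq_trans (size_prod_leq _ _) _.
rewrite leq_subLR (leq_trans _ (leq_addl _ _))// ltnS ltnW// ltnS.
apply: leq_trans (_ : \sum_(i : I) 3 <= _)%N; last first.
  by rewrite sum_nat_const mulnC.
apply: leq_sum => i _; rewrite /rotated_entry.
rewrite (leq_trans (size_polyD _ _))// geq_max (leq_trans (size_polyD _ _))/=.
  by rewrite (leq_trans (size_scale_leq _ _))// size_polyXn.
rewrite geq_max (leq_trans (size_polyC_leq1 _))//.
by rewrite (leq_trans (size_scale_leq _ _))// size_polyX.
Qed.

(** Each of the [#|I|] factors carries the normalization of [rotation_mx] twice, from V and from
    V^*, so removing it costs 1 + k^2 per factor. *)
Lemma rotation_moment H c d k : H^t* = H -> H *m H = 1%:M ->
  Cintegral mu (fun u => (rotated_monomial H c d (unitary_conj A u)).[k%:R]) =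
  (1 + k%:R ^+ 2) ^+ #|I| * haar_moment mu A c d.
Proof.
move=> Hh HH.
pose F (B : 'M[R[i]]_n) := \prod_i B (c i) (d i).
have uV := rotation_mx_unitary k Hh HH.
have bF := @bounded_measurable_monomial _ _ A _ c d.
rewrite /haar_moment -(haar_conj_invariant hmu (F := F) uV bF).
have bFV : bounded_measurableC (fun u : unitary_borel R n =>
    F (rotation_mx H k *m unitary_conj A u *m (rotation_mx H k)^t*)).
  apply: bounded_measurableC_prod => i; apply: bounded_measurable_mulmx.
  exact: bounded_measurable_unitary_conj.
rewrite -CintegralZ//; apply: eq_Cintegral => u.
rewrite /rotated_monomial horner_prod -prodr_const -big_split /=.
apply: eq_bigr => i _; rewrite rotated_entryE// /rotation_mx adjmxZ.
have s0 : 0 < 1 + k%:R ^+ 2 :> R[i] by rewrite ltr_wpDr// exprn_ge0.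
rewrite -!scalemxAl -scalemxAr scalerA [in RHS]mxE.
rewrite geC0_conj ?invr_ge0 ?sqrtC_ge0 ?ltW// -invfM -expr2 sqrtCK.
by rewrite mulrA divff ?mul1r// gt_eqF.
Qed.

(** The entry at (c, d) of the commutator of M, acting on tensors as a derivation, with the mean
    tensor power of X. *)
Definition lie_moment M c d : R[i] := Cintegral mu (fun u =>
  \sum_i (M *m unitary_conj A u - unitary_conj A u *m M) (c i) (d i) *
    \prod_(j | j != i) unitary_conj A u (c j) (d j)).

Lemma bounded_measurable_lie M c d :
  bounded_measurableC (fun u : unitary_borel R n =>
    \sum_i (M *m unitary_conj A u - unitary_conj A u *m M) (c i) (d i) *
      \prod_(j | j != i) unitary_conj A u (c j) (d j)).
Proof.
have bB := @bounded_measurable_unitary_conj _ _ A.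
apply: bounded_measurableC_sum => i; apply: bounded_measurableCM.
  apply: (@eq_bounded_measurableC _ _ _ (fun u : unitary_borel R n =>
    (M *m unitary_conj A u *m 1%:M) (c i) (d i) +
    -1 * (1%:M *m unitary_conj A u *m M) (c i) (d i))).
    by move=> u; rewrite mulmx1 mul1mx !mxE mulN1r.
  apply: bounded_measurableCD; first exact: bounded_measurable_mulmx.
  apply: bounded_measurableCM; first exact: bounded_measurableC_cst.
  exact: bounded_measurable_mulmx.
by apply: bounded_measurableC_prod => j; exact: bB.
Qed.

(* With w = 1 + k i H and Y = w X w^*, invariance makes E [prod_i Y_(c i)(d i)]
   equal to (1 + k^2)^#|I| times the moment at k = 0, for every natural k.
   Both sides are polynomials in k, and the right-hand one has no linear
   term. *)
Lemma lie_moment_reflection H c d : H^t* = H -> H *m H = 1%:M ->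
  lie_moment H c d = 0.
Proof.
move=> Hh HH.
pose P u := rotated_monomial H c d (unitary_conj A u).
have bP k : bounded_measurableC (fun u : unitary_borel R n => (P u)`_k).
  exact: bounded_measurable_rotated_monomial.
(* The mean of the random polynomial P; its coefficient of degree 1 will be i times the Lie
   moment. *)
pose q : {poly R[i]} :=
  \poly_(k < (3 * #|I|).+2) Cintegral mu (fun u => (P u)`_k).
have qE : q = haar_moment mu A c d *: (1 + 'X^2) ^+ #|I|.
  apply/eqP; rewrite -subr_eq0; apply/eqP/poly_nat_roots_eq0 => k.
  rewrite hornerD hornerN hornerZ horner_exp !hornerE mulrC.
  rewrite -(rotation_moment c d k Hh HH) horner_poly.
  apply/eqP; rewrite subr_eq0; apply/eqP.
  rewrite (eq_bigr (fun l : 'I_ _ =>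
     Cintegral mu (fun u => k%:R ^+ l * (P u)`_l))); last first.
    by move=> l _; rewrite mulrC CintegralZ.
  rewrite -Cintegral_sum; last first.
    move=> l; apply: bounded_measurableCM => //.
    exact: bounded_measurableC_cst.
  apply: eq_Cintegral => u.
  rewrite (horner_coef_wide _ (size_rotated_monomial H c d _)).
  by apply: eq_bigr => l _; rewrite mulrC.
have : q`_1 = 0 by rewrite qE coefZ coef1_expr_1X2 mulr0.
rewrite coef_poly /= => q1.
have {}q1 : 'i * lie_moment H c d = 0.
  rewrite -q1 -CintegralZ; last exact: bounded_measurable_lie.
  apply: eq_Cintegral => u; rewrite /P /rotated_monomial.
  rewrite coef1_prod ?index_enum_uniq//.
  rewrite mulr_sumr; apply: eq_bigr => i _; rewrite mulrA; congr (_ * _).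
    rewrite /rotated_entry !coefD !coefZ coefC coefX coefXn /=.
    by rewrite mulr1 mulr0 add0r addr0.
  apply: eq_bigr => j _.
  by rewrite /rotated_entry !coefD !coefZ coefC coefX coefXn /= !mulr0 !addr0.
by move/eqP: q1; rewrite mulf_eq0 (negbTE (neq0Ci _)) /= => /eqP.
Qed.

Lemma lie_momentD M1 M2 c d :
  lie_moment (M1 + M2) c d = lie_moment M1 c d + lie_moment M2 c d.
Proof.
rewrite -CintegralD; [|exact: bounded_measurable_lie..].
apply: eq_Cintegral => u; rewrite -big_split; apply: eq_bigr => i _ /=.
by rewrite -mulrDl mulmxDl mulmxDr; congr (_ * _); rewrite !mxE; ring.
Qed.

Lemma lie_momentZ a M c d : lie_moment (a *: M) c d = a * lie_moment M c d.
Proof.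
rewrite -CintegralZ; last exact: bounded_measurable_lie.
apply: eq_Cintegral => u; rewrite mulr_sumr; apply: eq_bigr => i _ /=.
by rewrite mulrA -scalemxAl -scalemxAr -scalerBr [in LHS]mxE.
Qed.

Lemma lie_moment1 c d : lie_moment 1%:M c d = 0.
Proof.
rewrite -[RHS](Cintegral_cst mu); apply: eq_Cintegral => u.
by apply: big1 => i _; rewrite mul1mx mulmx1 subrr mxE mul0r.
Qed.

(* x x^* is a combination of 1 and of the reflection 1 - 2 x x^* / (x^* x). *)
Lemma lie_moment_rank1 (x : 'cV[R[i]]_n) c d : lie_moment (x *m x^t*) c d = 0.
Proof.
pose s := (x^t* *m x) 0 0.
have xxE : x^t* *m x = s%:M by rewrite [LHS]mx11_scalar.
have sE : s = \sum_k `|x k 0| ^+ 2.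
  by rewrite /s !mxE; apply: eq_bigr => k _; rewrite !mxE normCKC.
have [s0|s0] := eqVneq s 0.
  have -> : x = 0.
    apply/matrixP => k j; rewrite ord1 mxE; apply/eqP.
    move/eqP: s0; rewrite sE psumr_eq0; last by move=> l _; rewrite exprn_ge0.
    by move=> /allP/(_ k (mem_index_enum k))/=; rewrite expf_eq0 normr_eq0.
  by rewrite mul0mx -(scale0r 1%:M) lie_momentZ mul0r.
have cs : s^* = s.
  by rewrite geC0_conj// sE sumr_ge0// => k _; rewrite exprn_ge0.
pose H := 1%:M + (- (2 / s)) *: (x *m x^t*).
have Hh : H^t* = H.
  rewrite adjmxD adjmx1 adjmxZ adjmx_mul adjmxK.
  by rewrite rmorphN rmorphM /= fmorphV /= cs conjC_nat.
have HH : H *m H = 1%:M.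
  rewrite /H mulmxDl mul1mx mulmxDr mulmx1 -scalemxAl -scalemxAr.
  rewrite -(mulmxA x) (mulmxA _ x) xxE mul_scalar_mx -scalemxAr scalerA.
  rewrite scalerA -addrA -scalerDl -scalerDl.
  rewrite [X in X *: _](_ : _ = 0) ?scale0r ?addr0//.
  by field.
have := lie_moment_reflection c d Hh HH.
rewrite lie_momentD lie_moment1 add0r lie_momentZ => /eqP.
rewrite mulf_eq0 oppr_eq0 mulf_eq0 invr_eq0 (negbTE s0) pnatr_eq0 /=.
by move/eqP.
Qed.

(** Polarization: with p and q the values at x y^* and y x^*, expanding at x + a y gives p + q = 0
    for a = 1 and p = q for a = i. Elementary matrices have this form. *)
Lemma lie_moment_rank1_polar (x y : 'cV[R[i]]_n) c d :
  lie_moment (x *m y^t*) c d = 0.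
Proof.
have h (a : R[i]) : lie_moment (x *m y^t*) c d * a^* +
    lie_moment (y *m x^t*) c d * a = 0.
  have := lie_moment_rank1 (x + a *: y) c d.
  rewrite adjmxD adjmxZ mulmxDl !mulmxDr -!scalemxAl -!scalemxAr.
  rewrite !(lie_momentD, lie_momentZ) !lie_moment_rank1 !mulr0 addr0 add0r.
  by rewrite mulrC [a * _]mulrC.
move: (lie_moment (x *m _) c d) (lie_moment (y *m _) c d) h => p q h.
have h1 := h 1; have hi := h 'i.
rewrite rmorph1 !mulr1 in h1; rewrite conjCi mulrN in hi.
move/eqP: h1; rewrite addr_eq0 => /eqP h1.
move/eqP: hi; rewrite h1 mulNr opprK -mulrDl mulf_eq0 (negbTE (neq0Ci _)) orbF.
by rewrite -mulr2n mulrn_eq0 /= => /eqP ->; rewrite oppr0.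
Qed.

Definition update c i b : I -> 'I_n := fun j => if j == i then b else c j.

(** Commutation with the elementary matrix E_ab, read entrywise: on the left it turns a value a of c
    into b, on the right a value b of d into a. *)
Lemma haar_moment_exchange c d (a b : 'I_n) :
  \sum_(i | c i == a) haar_moment mu A (update c i b) d =
  \sum_(i | d i == b) haar_moment mu A c (update d i a).
Proof.
apply/eqP; rewrite -subr_eq0; apply/eqP.
have := lie_moment_rank1_polar (delta_mx a 0) (delta_mx b 0) c d.
rewrite trmx_delta map_delta_mx mul_delta_mx => L0; rewrite -[RHS]L0.
have bm c' d' := @bounded_measurable_monomial _ _ A I c' d'.
rewrite /haar_moment -!Cintegral_sum//.
rewrite -CintegralB; [|exact: bounded_measurableC_sum..].
apply: eq_Cintegral => u /=.
move: (unitary_conj A u) => B.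
rewrite [in LHS]big_mkcond [X in _ - X]big_mkcond -sumrB.
apply: eq_bigr => i _; rewrite [in RHS]mxE [X in (_ + X) * _]mxE mulrBl.
have -> : (delta_mx a b *m B) (c i) (d i) = (c i == a)%:R * B b (d i).
  rewrite mxE (bigD1 b)//= !mxE eqxx andbT big1 ?addr0// => k kb.
  by rewrite mxE (negbTE kb) andbF mul0r.
have -> : (B *m delta_mx a b) (c i) (d i) = (d i == b)%:R * B (c i) a.
  rewrite mxE (bigD1 a)//= !mxE eqxx andTb big1 ?addr0 1?mulrC// => k ka.
  by rewrite mxE (negbTE ka) mulr0.
congr (_ - _).
  case: ifP => _; last by rewrite !mul0r.
  rewrite mul1r (bigD1 i)//= /update eqxx; congr (_ * _).
  by apply: eq_bigr => j /negbTE ->.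
case: ifP => _; last by rewrite !mul0r.
rewrite mul1r (bigD1 i)//= /update eqxx; congr (_ * _).
by apply: eq_bigr => j /negbTE ->.
Qed.

End LieInvariance.

(** * Expansion of the mixed moments over permutations *)

Section MomentExpansion.
Context (R : realType) (n : nat) (mu : probability (unitary_borel R n) R).
Hypothesis hmu : is_haar mu.
Context (A : 'M[R[i]]_n).

Lemma perm_mx_unitary (s : 'S_n) : (perm_mx s : 'M[R[i]]_n) \is unitarymx.
Proof.
apply/unitarymxP; rewrite tr_perm_mx map_perm_mx -perm_mxM mulgV.
exact: perm_mx1.
Qed.

Lemma perm_mx_conj (s : 'S_n) (B : 'M[R[i]]_n) i j :
  (perm_mx s *m B *m (perm_mx s)^t*) i j = B (s i) (s j).
Proof.
rewrite tr_perm_mx map_perm_mx -row_permE -col_permE.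
by rewrite !mxE.
Qed.

(** Permutation matrices are unitary, so rows and columns of X may be relabelled together. *)
Lemma haar_moment_perm (I : finType) (s : 'S_n) (c d : I -> 'I_n) :
  haar_moment mu A (fun i => s (c i)) (fun i => s (d i)) = haar_moment mu A c d.
Proof.
pose F (B : 'M[R[i]]_n) := \prod_i B (c i) (d i).
rewrite -[RHS](@haar_conj_invariant _ _ _ hmu A _ F (perm_mx_unitary s)).
  apply: eq_Cintegral => u; apply: eq_bigr => i _.
  by rewrite perm_mx_conj.
exact: bounded_measurable_monomial.
Qed.

(* Induction on the number of values of c. If c i0 = c i1 with i0 <> i1 and a is
   not a value of c, the exchange relation rewrites the moment of c through
   moments of c' := c[i0 <- a], which takes one more value. *)
Lemma haar_moment_expansion (c : 'I_n -> 'I_n) (p0 : 'S_n) :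
  haar_moment mu A c (fun i => c (p0 i)) =
  \sum_(p : 'S_n | [forall i, c (p i) == c (p0 i)]) haar_moment mu A id p.
Proof.
have [m] := ubnP (n - #|codom c|); elim: m => // m IHm in c p0 *.
rewrite ltnS => lem.
have [/injectiveP cI|] := boolP (injectiveb c).
  (* An injective c is itself a permutation: only p0 occurs, and c is removed by relabelling. *)
  rewrite (big_pred1 p0) => [|p]; last first.
    apply/forallP/eqP => [h|-> i //]; apply/permP => i.
    exact/cI/eqP/h.
  rewrite -[RHS](haar_moment_perm (perm cI)) /=; congr haar_moment.
    by apply: funext => i; rewrite permE.
  by apply: funext => i; rewrite permE.
case/injectivePn => i0 [i1 i01 ci01]; set b := c i0.
(* Pigeonhole: a c attaining every value would be injective. *)
have [a anc] : exists a, a \notin codom c.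
  apply/existsP; rewrite -negb_forall; apply: contra i01 => /forallP allc.
  have /image_injP cI : #|codom c| == #|'I_n|.
    by apply/eqP/eq_card => x; rewrite allc.
  exact/eqP/(cI i0 i1).
pose d i := c (p0 i); pose c' := update c i0 a.
have c'i0 : c' i0 = a by rewrite /c' /update eqxx.
have c'N i : i != i0 -> c' i = c i by rewrite /c' /update => /negbTE ->.
have cNa i : c i != a by apply: contraNneq anc => <-; exact: codom_f.
have ltc : (#|codom c| < #|codom c'|)%N.
  apply/proper_card/properP; split; last first.
    by exists a => //; rewrite -c'i0 codom_f.
  apply/fintype.subsetP => _ /codomP[i ->]; have [->|ii0] := eqVneq i i0.
    by rewrite ci01 -c'N 1?eq_sym// codom_f.
  by rewrite -c'N// codom_f.
have lec' : (#|codom c'| <= n)%N by rewrite -[leqRHS]card_ord max_card.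
have c'upd : update c' i0 b = c.
  by apply: funext => i; rewrite /c' /update; case: eqVneq => [->|].
transitivity (haar_moment mu A (update c' i0 b) d); first by rewrite c'upd.
(* c' takes the value a only at i0, so one side of the exchange relation is a single term. *)
transitivity (\sum_(i | c' i == a) haar_moment mu A (update c' i b) d).
  rewrite (big_pred1 i0)// => i; apply/eqP/eqP => [|->//].
  by apply: contra_eq => /c'N ->; exact: cNa.
rewrite haar_moment_exchange//.
(* The permutations are sorted by the index i with p i = i0, which matches the sum over i from the
   exchange. *)
rewrite [RHS](partition_big (fun p : 'S_n => (p^-1)%g i0)
  (fun i => d i == b)) /=.
  apply: eq_bigr => i /eqP dib.
  (* The induction hypothesis needs the second map as c' after a permutation. Swapping p0 i and i0
     is harmless elsewhere, as c agrees on these two points. *)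
  have dE : update d i a = fun j => c' ((p0 * tperm (p0 i) i0)%g j).
    apply: funext => j; rewrite /update permM; have [->|ji] := eqVneq.
      by rewrite tpermL.
    have [p0j|p0j] := eqVneq (p0 j) i0.
      rewrite p0j tpermR c'N ?[c _]dib /d ?p0j//.
      by rewrite -p0j (inj_eq perm_inj) eq_sym.
    by rewrite tpermD 1?eq_sym// ?c'N// (inj_eq perm_inj).
  rewrite dE IHm; last first.
    apply: leq_trans lem; apply: ltn_sub2l => //.
    exact: leq_trans ltc lec'.
  apply: eq_bigl => p.
  (* The value a marks i0 for c' and i for the updated d, so agreement of the two maps encodes p i =
     i0. *)
  transitivity [forall j, c' (p j) == update d i a j]; first by rewrite dE.
  apply/forallP/andP => [h|[/forallP h /eqP pi] j].
    have pi : p i = i0.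
      have := h i; rewrite /update eqxx -/(update c i0 a).
      by apply: contraTeq => /c'N; rewrite /c' => ->; exact: cNa.
    split; last by rewrite -pi permK.
    apply/forallP => j; have [->|ji] := eqVneq j i.
      by rewrite pi -/(d i) dib.
    have := h j; rewrite [update d i a j]/update (negbTE ji) -/(d j) c'N//.
    by rewrite -pi (inj_eq perm_inj).
  have {}pi : p i = i0 by rewrite -pi permKV.
  rewrite [X in _ == X]/update.
  case: (eqVneq j i) => [->|ji]; first by rewrite pi c'i0.
  by rewrite c'N ?h// -pi (inj_eq perm_inj).
move=> p /forallP /(_ ((p^-1)%g i0)); rewrite permKV eq_sym.
done.
Qed.

End MomentExpansion.

(** * Young subgroups *)

Section FiberPreservingPerms.
Context (T J : finType) (c : T -> J).

Local Notation fiber j := [set i | c i == j]%SET.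

(** The list [r] names the fibres that may move, so that they can be counted one at a time. *)
Definition fiber_perms (r : seq J) : {set {perm T}} :=
  [set p : {perm T} |
    [forall i, (c (p i) == c i) && ((c i \notin r) ==> (p i == i))]]%SET.

Lemma fiber_permsP (r : seq J) (p : {perm T}) :
  reflect (forall i, c (p i) = c i /\ (c i \notin r -> p i = i))
    (p \in fiber_perms r).
Proof.
rewrite inE; apply: (iffP forallP) => h i.
  by have /andP[/eqP-> /implyP k] := h i; split=> // /k /eqP.
by have [-> k] := h i; rewrite eqxx; apply/implyP => /k /eqP.
Qed.

(** Each p factors uniquely as s t, with s its restriction to the first fibre and t moving only the
    remaining ones. *)
Lemma card_fiber_perms (r : seq J) : uniq r ->
  #|fiber_perms r| = (\prod_(j <- r) (#|fiber j|)`!)%N.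
Proof.
elim: r => [_|j r IHr /= /andP[jr ur]].
  rewrite big_nil; apply/eqP/cards1P; exists 1%g; apply/setP => p.
  rewrite inE; apply/fiber_permsP/eqP => [h|-> i]; last by rewrite perm1.
  by apply/permP => i; rewrite perm1; have [_ ->] := h i.
rewrite big_cons -{}IHr// -card_perm.
have fixB (s : {perm T}) i : perm_on (fiber j) s -> c i != j -> s i = i.
  by move=> sj ij; apply: (out_perm sj); rewrite inE.
have stabB (s : {perm T}) i : perm_on (fiber j) s -> c i = j -> c (s i) = j.
  move=> sj ij; have := perm_closed i sj.
  by rewrite !inE ij eqxx => /eqP.
have -> : fiber_perms (j :: r) =
    ((fun st : {perm T} * {perm T} => (st.1 * st.2)%g) @:
      finset.setX [set s | perm_on (fiber j) s] (fiber_perms r))%SET.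
  apply/setP => p; apply/fiber_permsP/imsetP => [h|[[s t]]]; last first.
    rewrite !inE /= => /andP[sj] /forallP ht -> i; rewrite permM.
    have /fiber_permsP {}ht : t \in fiber_perms r by rewrite inE; exact/forallP.
    rewrite (ht _).1 inE negb_or; split; last first.
      by case/andP => ij ir; rewrite (fixB s)// (ht _).2.
    have [ij|ij] := eqVneq (c i) j; first by rewrite ij stabB.
    by rewrite (fixB s).
  have pN : p \in ('N(fiber j | 'P))%g.
    by apply/astabsP => i; rewrite !inE /= apermE (h i).1.
  pose s := restr_perm (fiber j) p.
  have sj : perm_on (fiber j) s := restr_perm_on _ _.
  have sE i : c i = j -> s i = p i.
    by move=> ij; rewrite restr_permE// inE ij.
  exists (s, s^-1 * p)%g; last by rewrite /= mulKVg.
  rewrite !inE /= sj /=.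
  suff : (s^-1 * p)%g \in fiber_perms r by rewrite inE.
  apply/fiber_permsP => i; rewrite permM.
  move: (permKV s i); move: ((s^-1)%g i) => k <-.
  have [kj|kj] := eqVneq (c k) j; first by rewrite sE.
  rewrite (fixB s)//; split; first by rewrite (h k).1.
  by move=> kr; rewrite (h k).2// inE negb_or kj.
rewrite card_in_imset ?cardsX ?cardsE// => -[s t] [s' t'].
rewrite !finset.in_setX /= => /andP[]; rewrite inE => sj /fiber_permsP tr.
case/andP; rewrite inE => s'j /fiber_permsP t'r st.
(* On fibre j both t and t' are trivial, so there the product determines s. *)
have ss' : s = s'.
  apply/permP => i; have [ij|ij] := eqVneq (c i) j; last by rewrite !fixB.
  have /permP/(_ i) := st; rewrite !permM.
  by rewrite (tr _).2 ?(t'r _).2 ?stabB.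
by move: st; rewrite ss' => /mulgI ->.
Qed.

Lemma card_fiber_preserving :
  #|[set p : {perm T} | [forall i, c (p i) == c i]]%SET| =
  (\prod_j (#|fiber j|)`!)%N.
Proof.
rewrite -card_fiber_perms ?index_enum_uniq//.
apply: eq_card => p; rewrite !inE; apply: eq_forallb => i.
by rewrite mem_index_enum andbT.
Qed.

End FiberPreservingPerms.

Lemma prod_fiber (R : comNzRingType) (T J : finType) (c : T -> J) (F : J -> R) :
  \prod_i F (c i) = \prod_j F j ^+ #|[set i | c i == j]%SET|.
Proof.
rewrite (partition_big c xpredT)//=; apply: eq_bigr => j _.
rewrite -prodr_const; apply: eq_big => i; first by rewrite inE.
by move=> /eqP ->.
Qed.

Lemma sumn_tuple n (eta : n.-tuple nat) : sumn eta = (\sum_i tnth eta i)%N.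
Proof. by rewrite sumnE big_tuple. Qed.

Section YoungBlocks.
Context (n : nat) (eta : n.-tuple nat).
Hypothesis eta_sum : sumn eta = n.

Lemma young_block_subproof (i : 'I_n) : (reshape_index eta i < n)%N.
Proof.
by rewrite -[X in (_ < X)%N](size_tuple eta) reshape_indexP// eta_sum.
Qed.

Definition young_block (i : 'I_n) : 'I_n := Ordinal (young_block_subproof i).

(** [flatten_index] enumerates block j by offsets, with inverse [reshape_offset]. *)
Lemma card_young_block (j : 'I_n) :
  #|[set i | young_block i == j]%SET| = tnth eta j.
Proof.
have nthE : nth 0%N eta j = tnth eta j by rewrite (tnth_nth 0%N).
have lt (k : 'I_(tnth eta j)) : (flatten_index eta j k < n)%N.
  by rewrite -[X in (_ < X)%N]eta_sum flatten_indexP// nthE.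
rewrite -[RHS]card_ord -[RHS](card_imset _ (f := fun k => Ordinal (lt k))).
  apply: eq_card => i; rewrite inE; apply/eqP/imsetP => [ij|[k _ ->]].
    have ij' : reshape_index eta i = j by rewrite -ij.
    have lk : (reshape_offset eta i < tnth eta j)%N.
      by rewrite -nthE -ij' reshape_offsetP// eta_sum.
    exists (Ordinal lk) => //; apply: val_inj => /=.
    by rewrite -ij' reshape_indexK.
  by apply: val_inj; rewrite /= flatten_indexKl// nthE.
move=> k l /(congr1 val) /= e; apply: val_inj.
by have := congr1 (reshape_offset eta) e; rewrite !flatten_indexKr ?nthE.
Qed.

Lemma card_young_subgroup :
  #|young_subgroup eta| = (\prod_j (tnth eta j)`!)%N.
Proof.
under eq_bigr do rewrite -card_young_block.
by rewrite -card_fiber_preserving; apply: eq_card => p; rewrite !inE.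
Qed.

End YoungBlocks.

(** * The averages [dhat] as moments of diagonal entries *)

Section DiagonalMoments.
Context (R : realType) (n : nat) (mu : probability (unitary_borel R n) R).
Hypothesis hmu : is_haar mu.
Context (A : 'M[R[i]]_n).

Definition diag_moment (k : 'I_n -> nat) : R[i] :=
  Cintegral mu (fun u => \prod_j unitary_conj A u j j ^+ k j).

(** Relabelling X by t conjugates s, so these moments form a class function. *)
Lemma haar_moment_conjg (s t : 'S_n) :
  haar_moment mu A id (s ^ t)%g = haar_moment mu A id s.
Proof.
rewrite -[RHS](haar_moment_perm hmu A t) /=; apply: eq_Cintegral => u.
rewrite (reindex_inj (perm_inj (s := t))); apply: eq_bigr => i _ /=.
by rewrite permJ.
Qed.

(** By the class-function property, each of the n! conjugations in the induced character contributes
    the same sum over the Young subgroup Y, and n! / |Y| is the multinomial coefficient. *)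
Lemma dhat_young_char (eta : n.-tuple nat) : sumn eta = n ->
  (multinomial R[i] eta)^-1 * dhat mu (young_char R[i] eta) A =
  diag_moment (tnth eta).
Proof.
move=> eta_sum; pose c := young_block eta_sum.
have -> : diag_moment (tnth eta) = haar_moment mu A c c.
  apply: eq_Cintegral => u; rewrite [RHS](prod_fiber c (fun j => _ j j)).
  by apply: eq_bigr => j _; rewrite card_young_block.
have -> : haar_moment mu A c c =
    \sum_(s in young_subgroup eta) haar_moment mu A id s.
  have := haar_moment_expansion hmu A c 1%g.
  under eq_fun do rewrite perm1.
  move=> ->; apply: eq_bigl => s; rewrite inE.
  by apply: eq_forallb => i; rewrite perm1.
rewrite /dhat /dfun.
rewrite [Cintegral _ _](_ : _ =
    \sum_s young_char R[i] eta s * haar_moment mu A id s); last first.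
  rewrite Cintegral_sum => [|s].
    apply: eq_bigr => s _; rewrite CintegralZ//.
    exact: bounded_measurable_monomial.
  apply: bounded_measurableCM; first exact: bounded_measurableC_cst.
  exact: bounded_measurable_monomial.
rewrite /young_char.
under eq_bigr do rewrite -mulrA mulr_suml.
rewrite -mulr_sumr exchange_big /=.
have sumY (t : 'S_n) : \sum_s ((s ^ t)%g \in young_subgroup eta)%:R *
    haar_moment mu A id s =
    \sum_(s in young_subgroup eta) haar_moment mu A id s.
  rewrite [RHS]big_mkcond [RHS](reindex_inj (conjg_inj t)) /=.
  apply: eq_bigr => s _; rewrite haar_moment_conjg.
  by case: ifP; rewrite ?mul1r ?mul0r.
under eq_bigr do rewrite sumY.
rewrite sumr_const card_Sn.
rewrite card_young_subgroup// /multinomial natr_prod.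
have n0 : n`!%:R != 0 :> R[i] by rewrite pnatr_eq0 -lt0n fact_gt0.
have e0 : \prod_(i < n) (tnth eta i)`!%:R != 0 :> R[i].
  by apply/prodf_neq0 => i _; rewrite pnatr_eq0 -lt0n fact_gt0.
by rewrite invfM invrK -mulrA mulVKf// -(mulr_natl (\sum_(s in _) _)) mulKf.
Qed.

End DiagonalMoments.

(** * Muirhead's inequality *)

Definition transfer n (k : 'I_n -> nat) (p q : 'I_n) : 'I_n -> nat :=
  fun i => if i == p then (k p).-1 else if i == q then (k q).+1 else k i.

Lemma sum_transfer n (k : 'I_n -> nat) (p q : 'I_n) (P : pred 'I_n) :
  p != q -> (0 < k p)%N -> P p -> P q ->
  (\sum_(i | P i) transfer k p q i = \sum_(i | P i) k i)%N.
Proof.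
move=> pq kp Pp Pq; rewrite (bigD1 p)// [RHS](bigD1 p)//=.
rewrite (bigD1 q) ?Pq 1?eq_sym// [in RHS](bigD1 q) ?Pq 1?eq_sym//=.
rewrite /transfer !eqxx eq_sym (negbTE pq) addnA [RHS]addnA.
congr (_ + _)%N; first by lia.
by apply: eq_bigr => i /andP[/andP[_ /negbTE ->] /negbTE ->].
Qed.

Section Muirhead.
Context (n : nat) (K : porderType ring_display) (D : ('I_n -> nat) -> K).
Hypothesis D_transfer : forall (k : 'I_n -> nat) (p q : 'I_n), p != q ->
  (k q < k p)%N -> D (transfer k p q) <= D k.

(* q is the first index with k q < k' q, and p < q any index with k' p < k p;
   moving one unit from p to q keeps k above k'. *)
Lemma dominance_monotone (k k' : 'I_n -> nat) :
  (forall i j : 'I_n, (i <= j)%N -> (k' j <= k' i)%N) ->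
  (forall j, (j <= n)%N ->
     \sum_(i < n | (i < j)%N) k' i <= \sum_(i < n | (i < j)%N) k i)%N ->
  (\sum_i k i = \sum_i k' i)%N ->
  D k' <= D k.
Proof.
(* Induction on the total deficit; truncated subtraction makes indices in surplus count 0. *)
move=> k'_anti; have [m] := ubnP (\sum_i (k' i - k i))%N.
elim: m => // m IHm in k *; rewrite ltnS => lem dom tot.
have [/forallP le|] := boolP [forall i, k' i <= k i]%N.
  suff -> : k = k' by [].
  apply: funext => i; apply/eqP; move/eqP: tot; rewrite eq_sym.
  rewrite (leqif_sum (fun j _ => leqif_geq (le j))).2 => /forallP/(_ i) /= ge.
  by rewrite eqn_leq ge le.
rewrite negb_forall => /existsP[q0 kq0]; rewrite -ltnNge in kq0.
pose q := [arg min_(q < q0 | (k q < k' q)%N) (q : nat)]%N.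
have [kq q_min] : (k q < k' q)%N /\
    (forall i : 'I_n, (i < q)%N -> (k' i <= k i)%N).
  rewrite /q; case: arg_minnP => // q1 kq1 min1; split=> // i.
  by rewrite ltnNge; apply: contraNleq; exact: min1.
(* Otherwise k <= k' before q and k q < k' q, violating dominance at q + 1. *)
have [p /andP[pq kp]] : exists p : 'I_n, (p < q)%N && (k' p < k p)%N.
  apply/existsP; apply/contraT; rewrite negb_exists => /forallP np.
  have := dom q.+1 (ltn_ord q); rewrite leqNgt => /negP[].
  rewrite (bigD1 q)//= [in ltnRHS](bigD1 q)//= -addSn leq_add//.
  apply: leq_sum => i /andP[iq inq].
  have {}iq : (i < q)%N by rewrite ltn_neqAle -ltnS iq andbT.
  by have := np i; rewrite iq /= -leqNgt.
have npq : p != q by rewrite neq_ltn pq.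
(* k q < k' q <= k' p < k p, the middle step because k' is nonincreasing. *)
have qp : (k q < k p)%N.
  apply: (leq_trans kq); apply: (leq_trans (k'_anti p q (ltnW pq))).
  exact: ltnW.
apply: le_trans (D_transfer npq qp); apply: IHm.
(* The deficit drops by one at q and stays 0 at p, where k p exceeded k' p. *)
- apply: leq_trans lem; rewrite (bigD1 q)//= [in ltnRHS](bigD1 q)//= -addSn.
  rewrite {1}/transfer eqxx eq_sym (negbTE npq) leq_add//; first by lia.
  apply: leq_sum => i /negbTE inq; rewrite /transfer inq.
  by case: eqP => [->|//]; lia.
(* Partial sums past q contain both p and q and do not change; up to q the new k still bounds k'
   termwise, by minimality of q. *)
- move=> j jn; have [qj|jq] := ltnP q j.
    rewrite sum_transfer//; first exact: dom.
      exact: leq_ltn_trans qp.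
    exact: ltn_trans qj.
  apply: leq_sum => i ij; rewrite /transfer.
  have iq : (i < q)%N := leq_trans ij jq.
  case: eqP => [->|_]; first by lia.
  by case: eqP iq => [->|_ /q_min//]; rewrite ltnn.
- by rewrite sum_transfer//; exact: leq_ltn_trans qp.
Qed.

End Muirhead.

(** With a = m + b + 1 the difference factors as x^b y^b (y^m - x^m)(y - x), whose last two factors
    have the same sign. *)
Lemma transfer_ineq (K : numDomainType) (x y : K) (a b : nat) :
  0 <= x -> 0 <= y -> (b < a)%N ->
  x ^+ a.-1 * y ^+ b.+1 + x ^+ b.+1 * y ^+ a.-1 <=
  x ^+ a * y ^+ b + x ^+ b * y ^+ a.
Proof.
move=> x0 y0; case: a => // a /=; rewrite ltnS => /subnK <-.
move: (a - b)%N => m.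
wlog xy : x y x0 y0 / x <= y.
  move=> h; have [xy|yx] := real_leP (ger0_real x0) (ger0_real y0).
    exact: h.
  have := h y x y0 x0 (ltW yx).
  by rewrite [leLHS]addrC [leRHS]addrC ![y ^+ _ * _]mulrC.
rewrite -subr_ge0.
have -> : x ^+ (m + b).+1 * y ^+ b + x ^+ b * y ^+ (m + b).+1 -
    (x ^+ (m + b) * y ^+ b.+1 + x ^+ b.+1 * y ^+ (m + b)) =
    x ^+ b * y ^+ b * ((y ^+ m - x ^+ m) * (y - x)).
  by rewrite !exprS !exprD; ring.
by rewrite !mulr_ge0 ?exprn_ge0// subr_ge0// lerXn2r.
Qed.

(** * Muirhead's inequality for diagonal moments *)

Section DiagonalMomentsMonotone.
Context (R : realType) (n : nat) (mu : probability (unitary_borel R n) R).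
Hypothesis hmu : is_haar mu.
Context (A : 'M[R[i]]_n).
Hypothesis hA : psdmx A.

(** The entry is v^* A v for v the adjoint of row j of u. *)
Lemma unitary_conj_diag_ge0 u j : 0 <= unitary_conj A u j j.
Proof.
have := hA.2 ((row j (val u))^t*).
rewrite adjmxK -row_mul mxE => h; rewrite (le_trans h)// le_eqVlt.
apply/orP; left; apply/eqP.
by rewrite mxE; apply: eq_bigr => k _; rewrite !mxE.
Qed.

Lemma bounded_measurable_diag k : bounded_measurableC
  (fun u : unitary_borel R n => \prod_j unitary_conj A u j j ^+ k j).
Proof.
apply: bounded_measurableC_prod => j; elim: (k j) => [|m IHm].
  by apply: eq_bounded_measurableC (bounded_measurableC_cst _ 1).
apply: (@eq_bounded_measurableC _ _ _ (fun u : unitary_borel R n =>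
  unitary_conj A u j j * unitary_conj A u j j ^+ m)).
  by move=> u; rewrite exprS.
by apply: bounded_measurableCM => //; exact: bounded_measurable_unitary_conj.
Qed.

Lemma diag_moment_perm (k : 'I_n -> nat) (s : 'S_n) :
  diag_moment mu A (fun i => k (s i)) = diag_moment mu A k.
Proof.
pose F (B : 'M[R[i]]_n) := \prod_j B j j ^+ k (s j).
rewrite /diag_moment.
have bF := bounded_measurable_diag (fun i => k (s i)).
rewrite -(@haar_conj_invariant _ _ _ hmu A _ F (perm_mx_unitary R s) bF).
apply: eq_Cintegral => u; rewrite /F [RHS](reindex_inj (perm_inj (s := s))).
by apply: eq_bigr => j _; rewrite perm_mx_conj.
Qed.

(** Doubling each moment and swapping p and q in one copy symmetrizes the integrand; [transfer_ineq]
    then applies pointwise, times the common nonnegative product over the other indices. *)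
Lemma diag_moment_transfer (k : 'I_n -> nat) (p q : 'I_n) : p != q ->
  (k q < k p)%N -> diag_moment mu A (transfer k p q) <= diag_moment mu A k.
Proof.
move=> pq kqp.
have bd := bounded_measurable_diag.
rewrite -(ler_pMn2r (n := 2)) // !mulr2n.
rewrite -{2}(diag_moment_perm (transfer k p q) (tperm p q)).
rewrite -{2}(diag_moment_perm k (tperm p q)).
rewrite -!CintegralD//; try exact: (bd (fun i => _ (tperm p q i))).
rewrite -subr_ge0 -CintegralB;
  try by apply: bounded_measurableCD; exact: bd (fun i => _).
apply: Cintegral_ge0 => u; rewrite subr_ge0.
have x0 := unitary_conj_diag_ge0 u.
move: (unitary_conj A u) x0 => B x0.
have split2 (f : 'I_n -> nat) : \prod_j B j j ^+ f j =
    B p p ^+ f p * B q q ^+ f q * \prod_(j | (j != p) && (j != q)) B j j ^+ f j.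
  by rewrite (bigD1 p)// (bigD1 q) 1?eq_sym//= mulrA.
rewrite !split2 tpermL tpermR /transfer !eqxx eq_sym (negbTE pq).
pose W := \prod_(j | (j != p) && (j != q)) B j j ^+ k j.
have W0 : 0 <= W by apply: prodr_ge0 => j _; rewrite exprn_ge0.
have WE f : (forall j, j != p -> j != q -> f j = k j) ->
    \prod_(j | (j != p) && (j != q)) B j j ^+ f j = W.
  by move=> h; apply: eq_bigr => j /andP[jp jq]; rewrite h.
have tD j : j != p -> j != q -> tperm p q j = j.
  by move=> jp jq; rewrite tpermD 1?eq_sym.
rewrite !WE; try by move=> j jp jq; rewrite ?tD// ?(negbTE jp) ?(negbTE jq).
by rewrite -!mulrDl ler_wpM2r// transfer_ineq.
Qed.

End DiagonalMomentsMonotone.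

Theorem theorem7 (R : realType) (n : nat) (hn : (1 <= n)%N)
    (eta eta' : n.-tuple nat)
    (heta : is_partition eta) (heta' : is_partition eta')
    (hdom : dominates eta eta')
    (mu : probability (unitary_borel R n) R) (hmu : is_haar mu)
    (A : 'M[R[i]]_n) (hA : psdmx A) :
  (multinomial R[i] eta)^-1 * dhat mu (young_char R[i] eta) A
    >= (multinomial R[i] eta')^-1 * dhat mu (young_char R[i] eta') A.
Proof.
have [/andP[_ /eqP sum_eta] /andP[sorted' /eqP sum_eta']] := (heta, heta').
rewrite !dhat_young_char//; apply: dominance_monotone => //.
- exact: diag_moment_transfer.
- move=> i j ij; rewrite !(tnth_nth 0%N).
  apply: (sorted_leq_nth _ _ _ sorted'); rewrite ?inE ?size_tuple//.
    by move=> a b c /= ba cb; exact: leq_trans cb ba.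
  by move=> a /=.
- by rewrite -!sumn_tuple sum_eta.
Qed.
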